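(* Let $G\sim\mathrm{ER}(n,p)$, let $\varepsilon\in[0,1/2)$, let $d=(n-1)p$, and let $\delta>0$. If $$\frac{d}{\log n}\ \ge\ (1+\delta)\left(\frac{4}{(1-2\varepsilon)^2}+\frac{4}{3(1-2\varepsilon)}\right),$$ then with probability at least $1-n^{-\delta}$ the semidefinite program $$\max\ \operatorname{Tr}(WX)\quad\text{s.t.}\quad X\succeq0,\ X_{ii}=1\ \forall i$$ has $gg^T$ as its unique optimal solution, where $g_i=(-1)^{x_i}$ (so $x$ is recovered up to global flip). When $\varepsilon\to1/2$ the condition is equivalent to $\frac{d}{\log n}\ge\frac{4(1+\delta)}{(1-2\varepsilon)^2}+o\!\left(\frac{1}{(1-2\varepsilon)^2}\right)$.
   Context: Model: $G=(V,E)$ with $V=[n]$ drawn from $\mathrm{ER}(n,p)$ (each edge present independently with probability $p$); unknown $x\in\{0,1\}^n$; for each edge $(i,j)$ one observes $Y_{(i,j)}=x_i\oplus x_j\oplus Z_{(i,j)}$ (mod 2) with $Z_{(i,j)}$ i.i.d. Bernoulli$(\varepsilon)$ independent of $G$. $W\in\mathbb{R}^{n\times n}$ is defined by $W(i,j)=(-1)^{Y_{(i,j)}}$ if $(i,j)\in E$ and $W(i,j)=0$ otherwise. Logarithms are natural. *)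

(* Defs.v *)
From HB Require Import structures.
From mathcomp Require Import all_boot.
From Stdlib Require Import Reals ClassicalEpsilon.

Set Implicit Arguments. Unset Strict Implicit. Unset Printing Implicit Defensive.

Local Open Scope R_scope.

(* A sample point: for each ordered pair (i,j) of vertices, a pair of bits
   (edge present?, noise bit Z). Only the coordinates with i < j are random;
   the others are forced to (false,false) (they carry weight 1 there and 0
   elsewhere), so the measure below is exactly the product of independent
   Bernoulli(p) edges and Bernoulli(eps) noises over unordered pairs. *)
Definition outcome (n : nat) := {ffun 'I_n * 'I_n -> bool * bool}.

Definition coord_weight (n : nat) (p eps : R) (i j : 'I_n) (c : bool * bool) : R :=
  if (ltn i j) then
    (if c.1 then p else 1 - p) * (if c.2 then eps else 1 - eps)
  else if c == (false, false) then 1 else 0.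

Definition weight (n : nat) (p eps : R) (w : outcome n) : R :=
  \big[Rmult/1]_(e : 'I_n * 'I_n) coord_weight p eps e.1 e.2 (w e).

Definition prob (n : nat) (p eps : R) (E : outcome n -> Prop) : R :=
  \big[Rplus/0]_(w : outcome n)
     (if excluded_middle_informative (E w) then weight p eps w else 0).

Definition Wmat (n : nat) (x : 'I_n -> bool) (w : outcome n) (i j : 'I_n) : R :=
  if i == j then 0 else
  let a := if (ltn i j) then i else j in
  let b := if (ltn i j) then j else i in
  let c := w (a, b) in
  if c.1 then (if xorb (xorb (x a) (x b)) c.2 then -1 else 1) else 0.

Definition gvec (n : nat) (x : 'I_n -> bool) (i : 'I_n) : R :=
  if x i then -1 else 1.

Definition trace_prod (n : nat) (A B : 'I_n -> 'I_n -> R) : R :=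
  \big[Rplus/0]_(i : 'I_n) \big[Rplus/0]_(j : 'I_n) (A i j * B j i).

Definition psd (n : nat) (X : 'I_n -> 'I_n -> R) : Prop :=
  (forall i j, X i j = X j i) /\
  (forall v : 'I_n -> R,
     0 <= \big[Rplus/0]_(i : 'I_n) \big[Rplus/0]_(j : 'I_n) (v i * X i j * v j)).

Definition sdp_feasible (n : nat) (X : 'I_n -> 'I_n -> R) : Prop :=
  psd X /\ (forall i, X i i = 1).

Definition unique_opt (n : nat) (W Y : 'I_n -> 'I_n -> R) : Prop :=
  sdp_feasible Y /\
  (forall X, sdp_feasible X -> X <> Y -> trace_prod W X < trace_prod W Y).

(* Main.v *)
Require Import Defs.
From HB Require Import structures.
From Stdlib Require Import Reals Lra Classical ClassicalEpsilon FunctionalExtensionality.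
From mathcomp Require Import all_boot.

(** Conjugating by [g] turns the observations into signs [a_e] in {-1,0,1} on the
    edges, and [gg^T] is the unique optimum as soon as the signed Laplacian
    [L = sum_e a_e d_e d_e^T], [d_e = e_i - e_j], is positive definite on the
    orthogonal of the constants: write the feasible matrix as a nonnegative
    combination of rank-one matrices [yy^T] and use [y^T L y > 0].

    The lower tail of [L] is bounded by a matrix Chernoff argument with the
    potential [tr X^m] in place of the trace exponential.  For a rank-one
    increment [f t = tr (X + t vv^T)^m] satisfies [f'' <= |v|^2 f'] when
    [X + t vv^T >= m - 1], hence [f t <= f 0 + (exp (|v|^2 t) - 1) / |v|^2 f' 0].
    Adding the edges one at a time with weights [t_e] such that
    [E exp (2 t_e) = 1], the potential is a supermartingale started from
    [c I], [c = m + O(1)].  If [L] is not positive definite, then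
    [tr X^m >= (c + g)^m] with [exp (- g) = (E exp (- 2 s a_e))^(n/2)], and
    Markov's inequality with [m -> oo] gives the bound [n exp (- g)].
    The choice [exp (2 s) = 1 + q], [q = 1 - 2 eps], yields
    [exp (- g) = (1 - p q^2 / 2)^(n/2) <= exp (- n p q^2 / 4)]. *)

Set Implicit Arguments. Unset Strict Implicit. Unset Printing Implicit Defensive.

(** * Real analysis: a Gronwall bound and the limit of large exponents *)

Section Calculus.
Local Open Scope R_scope.

(** The last two conclusions place [c] between 0 and [t] whatever the sign of [t], which spares
    later case splits. *)
Lemma MVT_between (f f' : R -> R) (t : R) :
  (forall s, derivable_pt_lim f s (f' s)) ->
  exists c, [/\ f t - f 0 = f' c * t, 0 <= c * t & Rabs c <= Rabs t].
Proof.
move=> df; case: (total_order_T 0 t) => [[t_gt0|<-]|t_lt0].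
- have [c [E [c0 ct]]] := MVT_cor2 f f' 0 t t_gt0 (fun s _ => df s).
  exists c; split; first by rewrite E; lra.
  - by apply: Rmult_le_pos; lra.
  - by rewrite !Rabs_pos_eq; lra.
- by exists 0; split; [lra|lra|exact: Rle_refl].
- have [c [E [c0 ct]]] := MVT_cor2 f f' t 0 t_lt0 (fun s _ => df s).
  exists c; split; first by lra.
  - by rewrite -Rmult_opp_opp; apply: Rmult_le_pos; lra.
  - by rewrite !Rabs_left; lra.
Qed.

Lemma derivable_pt_lim_expM (r t : R) :
  derivable_pt_lim (fun s => exp (r * s)) t (r * exp (r * t)).
Proof.
have -> : r * exp (r * t) = exp (r * t) * (r * 1) by ring.
apply: (derivable_pt_lim_comp (fun s => r * s) exp).
  exact: (derivable_pt_lim_scal id r t 1 (derivable_pt_lim_id t)).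
exact: derivable_pt_lim_exp.
Qed.

(** The hypothesis makes [exp (- r * s) * f1 s] nonincreasing, so [f1 s] lies below
    [exp (r * s) * f1 0] for [s >= 0] and above it for [s <= 0]. Integrating from 0 gives the same
    upper bound on both sides. *)
Lemma exp_Gronwall (f f1 f2 : R -> R) (r T : R) :
  0 < r ->
  (forall s, derivable_pt_lim f s (f1 s)) ->
  (forall s, derivable_pt_lim f1 s (f2 s)) ->
  (forall s, Rabs s <= T -> f2 s <= r * f1 s) ->
  forall t, Rabs t <= T -> f t <= f 0 + (exp (r * t) - 1) / r * f1 0.
Proof.
move=> r0 df df1 le21 t tT.
have dk s : derivable_pt_lim (fun s => - (exp (- r * s) * f1 s)) s
    (exp (- r * s) * (r * f1 s - f2 s)).
  have -> : exp (- r * s) * (r * f1 s - f2 s) =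
     - (- r * exp (- r * s) * f1 s + exp (- r * s) * f2 s) by ring.
  apply: (derivable_pt_lim_opp (fun s => exp (- r * s) * f1 s)).
  exact: derivable_pt_lim_mult (derivable_pt_lim_expM _ _) (df1 s).
have dh s : derivable_pt_lim (fun s => exp (r * s) * (f1 0 / r) - f s) s
    (r * exp (r * s) * (f1 0 / r) - f1 s).
  apply: (derivable_pt_lim_minus (fun s => exp (r * s) * (f1 0 / r)) f) => //.
  have -> : r * exp (r * s) * (f1 0 / r) = 
     r * exp (r * s) * (f1 0 / r) + exp (r * s) * 0 by ring.
  apply: (derivable_pt_lim_mult _ (fun=> f1 0 / r)).
    exact: derivable_pt_lim_expM.
  exact: derivable_pt_lim_const.
(* Two mean values replace the integration: one between 0 and [t], one between 0 and [c]. The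
   factors [t] and [c] they produce combine through [0 <= c * t]. *)
have [c [Ec c0 ct]] := MVT_between t dh.
have [d [Ed d0 dc]] := MVT_between c dk.
have le_d : 0 <= r * f1 d - f2 d by have := le21 d; lra.
have k0 : 0 <= (- (exp (- r * c) * f1 c) + f1 0) * t.
  have := Ed; rewrite Rmult_0_r exp_0 => E.
  have -> : - (exp (- r * c) * f1 c) + f1 0 = exp (- r * d) * (r * f1 d - f2 d) * c.
    by rewrite -E; ring.
  rewrite Rmult_assoc; apply: Rmult_le_pos => //.
  by apply: Rmult_le_pos => //; apply: Rlt_le; exact: exp_pos.
have e1 : exp (r * c) * exp (- r * c) = 1.
  by rewrite -exp_plus -exp_0; congr exp; ring.
have : 0 <= exp (r * c) * ((- (exp (- r * c) * f1 c) + f1 0) * t).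
  by apply: Rmult_le_pos => //; apply: Rlt_le; exact: exp_pos.
have -> : exp (r * c) * ((- (exp (- r * c) * f1 c) + f1 0) * t) =
   (exp (r * c) * f1 0 - exp (r * c) * exp (- r * c) * f1 c) * t by ring.
rewrite e1; move: Ec; rewrite Rmult_0_r exp_0.
have -> : r * exp (r * c) * (f1 0 / r) - f1 c = exp (r * c) * f1 0 - 1 * f1 c.
  by field; lra.
move=> <- h.
have -> : (exp (r * t) - 1) / r * f1 0 = exp (r * t) * (f1 0 / r) - 1 * (f1 0 / r).
  by field; lra.
lra.
Qed.

Lemma Rle_archimedean (x y z : R) :
  (forall k : nat, x <= y + z / INR k.+1) -> x <= y.
Proof.
move=> H; apply: Rnot_lt_le => yx.
have z0 : 0 < z by have := H 0%N; rewrite /= /Rdiv Rinv_1; lra.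
have [k [kz k0]] := archimed_cor1 ((x - y) / z) (Rdiv_lt_0_compat _ _ (Rlt_Rminus _ _ yx) z0).
have /(Rmult_lt_compat_l z _ _ z0) : / INR k.+1 < (x - y) / z.
  apply: Rle_lt_trans kz; apply: Rinv_le_contravar; first exact: lt_0_INR.
  by apply: le_INR; apply/leP.
have -> : z * ((x - y) / z) = x - y by field; lra.
by have := H k; rewrite /Rdiv; lra.
Qed.

(** With [a = m - 1 + K + g], the inequality [1 - g / a <= exp (- g / a)] bounds the ratio of the
    two powers by [exp (- g * m / a)], and [m / a] tends to 1. *)
Lemma exp_limit_bound (P A g K : R) : 0 <= P -> 0 <= A -> 0 <= g -> 0 <= K ->
  (forall k : nat, let m := (k.+1).*2 in
     P * (INR m - 1 + K + g) ^ m <= A * (INR m - 1 + K) ^ m) ->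
  P <= A * exp (- g).
Proof.
(* The exponent misses [- g] by [y = g * (g + K - 1) / a <= g * (g + K) / k.+1]; multiplied by [P],
   this is the error term. *)
move=> P0 A0 g0 K0 H; apply: (@Rle_archimedean _ _ (P * (g * (g + K)))) => k.
pose m := k.+1.*2.
have {}H : P * (INR m - 1 + K + g) ^ m <= A * (INR m - 1 + K) ^ m := H k.
have mk : 2 * INR k.+1 = INR m by rewrite /m -muln2 mulnC mult_INR.
have k1 : 1 <= INR k.+1 by apply: (le_INR 1); apply/leP.
set a := INR m - 1 + K + g in H.
have a0 : 0 < a by rewrite /a; lra.
have ca : INR m - 1 + K <= a * exp (- g / a).
  have -> : INR m - 1 + K = a * (1 + - g / a) by rewrite /a; field; rewrite -/a; lra.
  by apply: Rmult_le_compat_l; [lra|exact: exp_ineq1_le].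
have e_m : exp (- g / a) ^ m = exp (- g) * exp (g * (g + K - 1) / a).
  rewrite -Rpower_pow; last exact: exp_pos.
  rewrite /Rpower ln_exp -exp_plus; congr exp.
  have -> : INR m = a - (g + K - 1) by rewrite /a; ring.
  by field; lra.
have am : 0 < a ^ m by exact: pow_lt.
have {H} : P * a ^ m <= A * exp (- g) * exp (g * (g + K - 1) / a) * a ^ m.
  apply: Rle_trans H _.
  have -> : A * exp (- g) * exp (g * (g + K - 1) / a) * a ^ m = A * (a * exp (- g / a)) ^ m.
    by rewrite Rpow_mult_distr e_m; ring.
  by apply: Rmult_le_compat_l => //; apply: pow_incr; split => //; lra.
move/(Rmult_le_reg_r _ _ _ am) => H.
set y := g * (g + K - 1) / a in H.
have yk : y <= g * (g + K) / INR k.+1.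
  apply: (@Rle_trans _ (g * (g + K) / a)).
    apply: Rmult_le_compat_r; first exact/Rlt_le/Rinv_0_lt_compat.
    by apply: Rmult_le_compat_l => //; lra.
  apply: Rmult_le_compat_l; first by apply: Rmult_le_pos; lra.
  by apply: Rinv_le_contravar; rewrite /a; lra.
have Py : P * (1 - y) <= A * exp (- g).
  apply: (@Rle_trans _ (P * exp (- y))).
    by apply: Rmult_le_compat_l => //; have := exp_ineq1_le (- y); lra.
  have e1 : exp y * exp (- y) = 1 by rewrite -exp_plus Rplus_opp_r exp_0.
  have := Rmult_le_compat_r _ _ _ (Rlt_le _ _ (exp_pos (- y))) H.
  by rewrite Rmult_assoc e1 Rmult_1_r.
have := Rmult_le_compat_l _ _ _ P0 yk.
have -> : P * (g * (g + K)) / INR k.+1 = P * (g * (g + K) / INR k.+1) by rewrite /Rdiv; ring.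
lra.
Qed.

End Calculus.

(** * The tilted edge weights and the numerical form of the degree condition *)

Section Scalars.
Local Open Scope R_scope.

(** The entry of [W] after conjugation by [g]: it depends on the edge bit and the noise bit, no
    longer on [x]. *)
Definition sign_weight (c : bool * bool) : R :=
  if c.1 then (if c.2 then -1 else 1) else 0.

(* Before normalisation [exp (2 * tilt)] is [1 / (1 + q)], [1 + q], [1] at the
   signs [1], [-1], [0]; [mean_mgf] is its mean when [q = 1 - 2 * eps]. *)
Definition mean_mgf (p q : R) : R := 1 - p * q ^ 2 / 2.

Definition tilt (p q : R) (c : bool * bool) : R :=
  - (ln (1 + q) / 2) * sign_weight c - ln (mean_mgf p q) / 2.

Lemma mean_mgf_bounds p q : 0 <= p <= 1 -> 0 < q <= 1 -> 0 < mean_mgf p q <= 1.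
Proof. by move=> hp hq; rewrite /mean_mgf; nra. Qed.

Lemma exp_tilt p q c : 0 <= p <= 1 -> 0 < q <= 1 ->
  exp (2 * tilt p q c) =
  (if c.1 then (if c.2 then 1 + q else / (1 + q)) else 1) / mean_mgf p q.
Proof.
move=> hp hq; have [E0 _] := mean_mgf_bounds hp hq.
have -> : 2 * tilt p q c = - sign_weight c * ln (1 + q) + - ln (mean_mgf p q).
  by rewrite /tilt; field.
rewrite exp_plus exp_Ropp exp_ln // /Rdiv; congr (_ * _).
rewrite /sign_weight; case: c.1; last by rewrite Ropp_0 Rmult_0_l exp_0.
case: c.2.
  have -> : - -1 * ln (1 + q) = ln (1 + q) by ring.
  by rewrite exp_ln //; lra.
have -> : - 1 * ln (1 + q) = - ln (1 + q) by ring.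
by rewrite exp_Ropp exp_ln //; lra.
Qed.

(** As [eps = (1 - q) / 2], one has [eps * (1 + q) = (1 - q ^ 2) / 2] and
    [(1 - eps) / (1 + q) = 1 / 2], so the mean before normalisation is [1 - p * q ^ 2 / 2]. *)
Lemma tilt_mgf p eps : 0 <= p <= 1 -> 0 <= eps < 1 / 2 ->
  let q := 1 - 2 * eps in
  p * eps * exp (2 * tilt p q (true, true)) +
  p * (1 - eps) * exp (2 * tilt p q (true, false)) +
  ((1 - p) * eps * exp (2 * tilt p q (false, true)) +
   (1 - p) * (1 - eps) * exp (2 * tilt p q (false, false))) = 1.
Proof.
move=> hp he q; have hq : 0 < q <= 1 by rewrite /q; lra.
have [E0 _] := mean_mgf_bounds hp hq.
rewrite !exp_tilt //=.
have epsE : eps = (1 - q) / 2 by rewrite /q; field.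
move: q hq E0 epsE => q hq E0 ->.
have ME : mean_mgf p q = 1 - p * (q * q) / 2 by rewrite /mean_mgf /= Rmult_1_r.
by move: E0; rewrite ME => E0; field; lra.
Qed.

Lemma ln_nonpos x : x <= 0 -> ln x = 0.
Proof. by move=> x0; rewrite /ln; case: (Rlt_dec 0 x) => // h; exfalso; lra. Qed.

(** For [n = 0] and [n = 1] the conventions [ln 0 = 0] and [/ 0 = 0], or [ln 1 = 0], make the
    quotient 0, below [B]. *)
Lemma degree_condition_gt1 (n : nat) (p B : R) :
  0 < B -> (INR n - 1) * p / ln (INR n) >= B -> 1 < INR n.
Proof.
case: n => [|[|n]] B0.
- by rewrite /= ln_nonpos /Rdiv ?Rinv_0; lra.
- by rewrite /= ln_1 /Rdiv Rinv_0; lra.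
by move=> _; apply: (lt_INR 1); apply/ltP.
Qed.

(** By [ln y <= y - 1] the left side is at most [exp (ln n - n * p * q ^ 2 / 4)], while the degree
    condition gives [(n - 1) * p * q ^ 2 >= 4 * (1 + delta) * ln n]. *)
Lemma tail_le_Rpower (n p q delta : R) :
  1 < n -> 0 <= p <= 1 -> 0 < q <= 1 -> 0 < delta ->
  (n - 1) * p / ln n >= (1 + delta) * (4 / q ^ 2 + 4 / (3 * q)) ->
  n * exp (- (- (ln (mean_mgf p q) / 2) * n)) <= Rpower n (- delta).
Proof.
move=> n1 hp hq d0 H.
have ln0 : 0 < ln n by rewrite -ln_1; apply: ln_increasing; lra.
have [E0 _] := mean_mgf_bounds hp hq.
have lnE : ln (mean_mgf p q) <= - (p * q ^ 2 / 2).
  have := exp_ineq1_le (ln (mean_mgf p q)); rewrite exp_ln // /mean_mgf; lra.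
have q2 : 0 < q ^ 2 by apply: pow_lt; lra.
move: (q ^ 2) q2 H lnE => Q q2 H lnE.
have q3 : 0 < 4 / (3 * q) by apply: Rdiv_lt_0_compat; lra.
have {}H : (1 + delta) * 4 / Q <= (n - 1) * p / ln n.
  apply: Rle_trans (Rge_le _ _ H).
  have -> : (1 + delta) * 4 / Q = (1 + delta) * (4 / Q) by field; lra.
  by apply: Rmult_le_compat_l; lra.
have {}H : (1 + delta) * 4 * ln n <= (n - 1) * p * Q.
  have := Rmult_le_compat_r _ _ _ (Rlt_le _ _ (Rmult_lt_0_compat _ _ q2 ln0)) H.
  have -> : (1 + delta) * 4 / Q * (Q * ln n) = (1 + delta) * 4 * ln n by field; lra.
  by have -> : (n - 1) * p / ln n * (Q * ln n) = (n - 1) * p * Q by field; lra.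
rewrite /Rpower -{1}(exp_ln n); last by lra.
rewrite -exp_plus.
have le_e : ln n + - (- (ln (mean_mgf p q) / 2) * n) <= - delta * ln n.
  have := Rmult_le_compat_r n _ _ _ lnE.
  have : 0 <= p * Q by apply: Rmult_le_pos; lra.
  by nra.
by case: (Rle_lt_or_eq_dec _ _ le_e) => [/exp_increasing/Rlt_le|->]; [|exact: Rle_refl].
Qed.

End Scalars.

From mathcomp Require Import all_order all_algebra.
From mathcomp Require Import Rstruct.
From mathcomp Require Import ring lra zify.
Import Order.TTheory GRing.Theory Num.Theory.

Local Open Scope ring_scope.
Local Arguments exp _%_ring_scope.

(** * Bilinear forms and moment inequalities for powers of a positive matrix *)

Section QuadraticForms.
Variables (F : realFieldType) (n : nat).
Implicit Types (A B X : 'M[F]_n) (u v w : 'cV[F]_n).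

Definition form A u v : F := (u^T *m A *m v) 0 0.

Lemma formE A u v : form A u v = \sum_i \sum_j u i 0 * A i j * v j 0.
Proof.
rewrite /form mxE exchange_big /=; apply: eq_bigr => j _.
rewrite mxE big_distrl /=; apply: eq_bigr => i _; by rewrite !mxE.
Qed.

Lemma form1E u v : form 1 u v = \sum_i u i 0 * v i 0.
Proof. by rewrite /form mulmx1 mxE; apply: eq_bigr => i _; rewrite mxE. Qed.

Lemma formDl A u v w : form A (u + v) w = form A u w + form A v w.
Proof. by rewrite /form linearD /= !mulmxDl mxE. Qed.

Lemma formDr A u v w : form A w (u + v) = form A w u + form A w v.
Proof. by rewrite /form !mulmxDr mxE. Qed.

Lemma formZl A c u v : form A (c *: u) v = c * form A u v.
Proof. by rewrite /form linearZ /= -!scalemxAl mxE. Qed.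

Lemma formZr A c u v : form A u (c *: v) = c * form A u v.
Proof. by rewrite /form -!scalemxAr mxE. Qed.

Lemma formDm A B u v : form (A + B) u v = form A u v + form B u v.
Proof. by rewrite /form mulmxDr mulmxDl mxE. Qed.

Lemma formZm A c u v : form (c *: A) u v = c * form A u v.
Proof. by rewrite /form -scalemxAr -scalemxAl mxE. Qed.

Lemma form_sum I (r : seq I) (P : pred I) (M : I -> 'M[F]_n) u v :
  form (\sum_(i <- r | P i) M i) u v = \sum_(i <- r | P i) form (M i) u v.
Proof.
apply: (big_morph (fun A => form A u v)) => [A B|]; first exact: formDm.
by rewrite /form mulmx0 mul0mx mxE.
Qed.

Lemma form_tr A u v : form A u v = form A^T v u.
Proof.
rewrite /form -[in RHS](trmxK u) -mulmxA -!trmx_mul mulmxA.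
by rewrite [RHS]mxE.
Qed.

Lemma formC A u v : A^T = A -> form A u v = form A v u.
Proof. by move=> sA; rewrite form_tr sA. Qed.

Lemma form_outer u v w : form (w *m w^T) u v = form 1 w u * form 1 w v.
Proof.
rewrite /form !mulmx1 !mulmxA -(mulmxA (u^T *m w)) mxE big_ord1.
congr (_ * _); by rewrite -[u^T *m w]trmxK trmx_mul trmxK mxE.
Qed.

Lemma form1_ge0 u : 0 <= form 1 u u.
Proof. by rewrite form1E; apply: sumr_ge0 => i _; rewrite -expr2 sqr_ge0. Qed.

Lemma form1_eq0 u : form 1 u u = 0 -> u = 0.
Proof.
rewrite form1E => /eqP; rewrite psumr_eq0 => [|i _]; last by rewrite -expr2 sqr_ge0.
move/allP => h; apply/colP => i; rewrite mxE; have := h i; rewrite mem_index_enum.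
by rewrite mulf_eq0 orbb => /(_ isT)/eqP.
Qed.

Lemma form1_gt0 u : u != 0 -> 0 < form 1 u u.
Proof.
move=> nz; rewrite lt_neqAle form1_ge0 andbT eq_sym; apply: contraNN nz.
by move/eqP/form1_eq0 => ->.
Qed.

(** Discriminant argument on [u + t *: v], with a separate case when the leading coefficient
    [form A v v] vanishes. *)
Lemma form_CS A u v : A^T = A -> (forall w, 0 <= form A w w) ->
  form A u v ^+ 2 <= form A u u * form A v v.
Proof.
move=> sA pA.
have q t : 0 <= form A u u + 2 * t * form A u v + t ^+ 2 * form A v v.
  have := pA (u + t *: v).
  rewrite !formDl !formDr !formZl !formZr (formC v u sA) => h.
  by apply: le_trans h _; rewrite le_eqVlt; apply/orP; left; apply/eqP; ring.
have c0 := pA v; have a0 := pA u.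
have [c1|c1] := boolP (0 < form A v v).
  have := q (- (form A u v / form A v v)).
  have -> : form A u u + 2 * - (form A u v / form A v v) * form A u v +
     (- (form A u v / form A v v)) ^+ 2 * form A v v
     = form A u u - form A u v ^+ 2 / form A v v.
    by field; rewrite gt_eqF.
  by rewrite subr_ge0 ler_pdivrMr.
have c2 : form A v v = 0 by apply/eqP; rewrite eq_le c0 andbT leNgt.
rewrite c2 mulr0; case: (eqVneq (form A u v) 0) => [->|b0]; first by rewrite expr0n.
(* The polynomial is now affine in [t], and this [t] gives it the value -1. *)
have := q (- ((form A u u + 1) / (2 * form A u v))); rewrite c2 mulr0 addr0.
have -> : form A u u + 2 * - ((form A u u + 1) / (2 * form A u v)) * form A u v = -1.
  by field.
by rewrite lerNr oppr0 ler10.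
Qed.

Lemma trmxX A k : A^T = A -> (A ^+ k)^T = A ^+ k.
Proof.
by move=> sA; elim: k => [|k IH]; rewrite ?expr0 ?trmx1 // [in LHS]exprSr trmx_mul IH sA exprS.
Qed.

Lemma form_mul A B u v : A^T = A -> form (A * B) u v = form B (A *m u) v.
Proof. by move=> sA; rewrite /form trmx_mul sA !mulmxA. Qed.

(** With [form_exprDS], this stands in for the spectral theorem: a moment of even order becomes a
    value of [form 1], one of odd order a value of [form X], and Cauchy-Schwarz applies to both. *)
Lemma form_exprD X a b u : X^T = X ->
  form (X ^+ (a + b)) u u = form 1 (X ^+ a *m u) (X ^+ b *m u).
Proof.
by move=> sX; rewrite exprD form_mul ?trmxX // /form mulmx1 mulmxA.
Qed.

Lemma form_exprDS X a b u : X^T = X ->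
  form (X ^+ (a + b).+1) u u = form X (X ^+ a *m u) (X ^+ b *m u).
Proof.
move=> sX; rewrite -addnS exprD exprS form_mul ?trmxX //.
by rewrite form_mul // /form trmx_mul sX !mulmxA.
Qed.

Definition bounded_below X (b : F) := forall u, b * form 1 u u <= form X u u.

Section PositiveMatrix.
Variables (X : 'M[F]_n) (b : F) (v : 'cV[F]_n).
Hypotheses (sX : X^T = X) (b_gt0 : 0 < b) (bX : bounded_below X b).

Let X_ge0 u : 0 <= form X u u.
Proof. by apply: le_trans (bX u); rewrite mulr_ge0 ?form1_ge0 // ltW. Qed.

(** The moments of the spectral measure of [X] at [v], which is carried by [[b, oo)]. *)
Let m k := form (X ^+ k) v v.

Lemma form_expr_ge0 k u : 0 <= form (X ^+ k) u u.
Proof.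
rewrite -[k]odd_double_half -addnn; case: (odd k); rewrite ?add0n ?add1n.
  by rewrite form_exprDS.
by rewrite form_exprD // form1_ge0.
Qed.

Lemma form_expr_mono k : b * m k <= m k.+1.
Proof.
rewrite /m -[k]odd_double_half -addnn; case: (odd k); rewrite ?add0n ?add1n.
  rewrite form_exprDS // -addnS -addSn form_exprD //.
  set w := X ^+ _ *m v.
  have -> : X ^+ (k./2).+1 *m v = X *m w by rewrite exprS -mulmxA.
  (* [b <= X] gives [b |w| <= |Xw|], and [<w, Xw> <= |w| |Xw|] *)
  have E1 : form X w w = form 1 w (X *m w) by rewrite /form mulmx1 mulmxA.
  have CS : form X w w ^+ 2 <= form 1 w w * form 1 (X *m w) (X *m w).
    by rewrite E1; apply: form_CS; [rewrite trmx1 | exact: form1_ge0].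
  have := bX w; have := X_ge0 w; have := form1_ge0 w.
  move: CS; have := form1_ge0 (X *m w).
  set a := form X w w; set c := form 1 w w; set d := form 1 (X *m w) _.
  move=> d0 CS c0 a0 bc.
  have [a1|a1] := boolP (0 < a); last first.
    have -> : a = 0 by apply/eqP; rewrite eq_le a0 andbT leNgt.
    by rewrite mulr0.
  rewrite -(ler_pM2r a1).
  have : b * a ^+ 2 <= b * (c * d) by rewrite ler_pM2l.
  have : (b * c) * d <= a * d by apply: ler_wpM2r.
  rewrite expr2; move=> h1 h2; rewrite -mulrA (mulrC d).
  by apply: le_trans h2 _; rewrite mulrA.
rewrite form_exprDS // form_exprD //; exact: bX.
Qed.

Lemma form_expr_logconvex k : m k.+1 ^+ 2 <= m k * m k.+2.
Proof.
rewrite /m -[k]odd_double_half -addnn; move: k./2 => j.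
have e1 : (j + j).+1 = (j.+1 + j)%N by rewrite addSn.
have e2 : (j + j).+2 = (j.+1 + j.+1)%N by rewrite addnS.
case: (odd k); rewrite ?add0n ?add1n.
  have -> : form (X ^+ (j + j).+2) v v = form X (X ^+ j.+1 *m v) (X ^+ j *m v).
    by rewrite e1 form_exprDS.
  have -> : form (X ^+ (j + j).+3) v v = form X (X ^+ j.+1 *m v) (X ^+ j.+1 *m v).
    by rewrite e2 form_exprDS.
  by rewrite form_exprDS // mulrC; exact: form_CS.
rewrite e2 e1 !form_exprD // mulrC.
by apply: form_CS; [exact: trmx1|exact: form1_ge0].
Qed.

Lemma form_expr_gt0 k : v != 0 -> 0 < m k.
Proof.
move=> nz; elim: k => [|k IH]; first by rewrite /m expr0 form1_gt0.
by apply: lt_le_trans (form_expr_mono k); apply: mulr_gt0.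
Qed.

(** Log-convexity makes the ratios [m k.+1 / m k] nondecreasing ([ratio]); shifting the exponents
    apart one unit at a time, until the smaller is 0, can then only increase the product
    ([half]). *)
Lemma form_expr_superM a c : v != 0 -> m a * m c <= m 0 * m (a + c)%N.
Proof.
move=> nz; have m_gt0 k := form_expr_gt0 k nz.
have ratio i j : m i.+1 * m (i + j)%N <= m i * m (i + j).+1.
  elim: j => [|j IH]; first by rewrite addn0 mulrC.
  rewrite addnS -(ler_pM2r (m_gt0 (i + j)%N)).
  have := form_expr_logconvex (i + j)%N; rewrite expr2 => L.
  have := ler_wpM2l (ltW (m_gt0 i)) L => L'.
  have := ler_wpM2r (ltW (m_gt0 (i + j).+1)) IH => L''.
  apply: le_trans (le_trans L'' _).
    by rewrite le_eqVlt -mulrA (mulrC (m (i + j).+1)) mulrA eqxx.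
  by apply: le_trans (le_trans L' _); rewrite le_eqVlt; apply/orP; left;
     apply/eqP; ring.
have half i j : m i * m (i + j)%N <= m 0 * m (i + (i + j))%N.
  elim: i j => [|i IH] j; first by rewrite !add0n.
  have := ratio i j.+1; rewrite !addSn !addnS => h.
  by apply: le_trans h _; have := IH j.+2; rewrite !addnS.
case: (leqP a c) => [/subnKC e|/ltnW /subnKC e]; first by have := half a (c - a)%N; rewrite e.
by have := half c (a - c)%N; rewrite e mulrC addnC.
Qed.

Lemma form_expr_Jensen k : form 1 v v = 1 -> m 1 ^+ k <= m k.
Proof.
move=> v1; have nz : v != 0.
  apply/eqP => v0; move: v1; rewrite v0 /form mulmx0 mxE => /eqP.
  by rewrite eq_sym oner_eq0.
have m0 : m 0 = 1 by rewrite /m expr0.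
elim: k => [|k IH]; first by rewrite expr0 m0.
rewrite exprS; apply: le_trans (ler_wpM2l _ IH) _; first exact: form_expr_ge0.
by apply: le_trans (form_expr_superM 1 k nz) _; rewrite m0 mul1r add1n.
Qed.

(** For symmetric [Y = X ^+ k], the trace of [Y * Y] is the sum of the squared row norms, and
    Cauchy-Schwarz on each row bounds [|Yv|^2]. Hence the even exponents later on. *)
Lemma form_expr_le_mxtrace k : form (X ^+ (k + k)) v v <= \tr (X ^+ (k + k)) * form 1 v v.
Proof.
rewrite form_exprD // exprD.
have sY : (X ^+ k)^T = X ^+ k by exact: trmxX.
move: (X ^+ k) sY => Y sY.
rewrite form1E /mxtrace big_distrl /=; apply: ler_sum => i _.
have -> : (Y *m v) i 0 = form 1 (row i Y)^T v.
  by rewrite form1E mxE; apply: eq_bigr => j _; rewrite !mxE.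
have -> : (Y * Y) i i = form 1 (row i Y)^T (row i Y)^T.
  rewrite form1E mxE; apply: eq_bigr => j _; rewrite !mxE; congr (_ * _).
  by rewrite -[in LHS]sY mxE.
by rewrite -expr2; apply: form_CS; [exact: trmx1|exact: form1_ge0].
Qed.

End PositiveMatrix.

Lemma bounded_below_outer X b t v : bounded_below X b ->
  bounded_below (X + t *: (v *m v^T)) (b - `|t| * form 1 v v).
Proof.
move=> bX u; rewrite formDm formZm form_outer -expr2.
have CS : form 1 v u ^+ 2 <= form 1 v v * form 1 u u.
  by apply: form_CS; [exact: trmx1|exact: form1_ge0].
have h1 : - `|t| * form 1 v u ^+ 2 <= t * form 1 v u ^+ 2.
  by apply: ler_wpM2r; [exact: sqr_ge0 | rewrite lerNl -normrN ler_norm].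
have h2 := ler_wpM2l (normr_ge0 t) CS; have := bX u; nra.
Qed.

End QuadraticForms.

(** * Derivatives of matrix powers along a rank-one line *)

Lemma derivable_pt_lim_sum I (r : seq I) (f : I -> R -> R) (f' : I -> R) t :
  (forall i, derivable_pt_lim (f i) t (f' i)) ->
  derivable_pt_lim (fun s => \sum_(i <- r) f i s) t (\sum_(i <- r) f' i).
Proof.
move=> df; elim: r => [|i r IH].
  apply: (derivable_pt_lim_ext (fun=> 0)) => [s|]; first by rewrite big_nil.
  by rewrite big_nil; exact: derivable_pt_lim_const.
apply: (derivable_pt_lim_ext (fun s => f i s + \sum_(j <- r) f j s)) => [s|].
  by rewrite big_cons.
by rewrite big_cons; exact: derivable_pt_lim_plus.
Qed.

Lemma derivable_pt_lim_expmx n (H V : 'M[R]_n) k t i j :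
  derivable_pt_lim (fun s => ((H + s *: V) ^+ k) i j) t
    ((\sum_(a < k) (H + t *: V) ^+ a * V * (H + t *: V) ^+ (k.-1 - a)) i j).
Proof.
elim: k i j => [|k IH] i j.
  apply: (derivable_pt_lim_ext (fun=> (1 : 'M[R]_n) i j)) => [s|]; first by rewrite expr0.
  by rewrite big_ord0 [X in derivable_pt_lim _ _ X]mxE; exact: derivable_pt_lim_const.
set B := fun s : R => H + s *: V.
apply: (derivable_pt_lim_ext (fun s => \sum_l B s i l * (B s ^+ k) l j)) => [s|].
  by rewrite exprS [RHS]mxE.
have -> : (\sum_(a < k.+1) B t ^+ a * V * B t ^+ (k.+1.-1 - a)) i j =
  \sum_l (V i l * (B t ^+ k) l j + B t i l *
     (\sum_(a < k) B t ^+ a * V * B t ^+ (k.-1 - a)) l j).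
  rewrite big_ord_recl expr0 mul1r subn0 mxE big_split /=; congr (_ + _).
    by rewrite mxE.
  transitivity ((B t * \sum_(a < k) B t ^+ a * V * B t ^+ (k.-1 - a)) i j); last by rewrite mxE.
  rewrite big_distrr /=; congr ((_ : 'M_n) i j); apply: eq_bigr => a _.
  by rewrite /bump /= add1n exprS !mulrA subnS -[in LHS]subn1 subnAC subn1.
apply: derivable_pt_lim_sum => l.
apply: derivable_pt_lim_mult; last exact: IH.
apply: (derivable_pt_lim_ext (fun s => H i l + s * V i l)) => [s|]; first by rewrite !mxE.
have {2}-> : V i l = 0 + (1 * V i l + t * 0) by ring.
apply: (derivable_pt_lim_plus (fun=> H i l) (fun s => s * V i l)).
  exact: derivable_pt_lim_const.
apply: (derivable_pt_lim_mult id (fun=> V i l)); first exact: derivable_pt_lim_id.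
exact: derivable_pt_lim_const.
Qed.

(** In the noncommutative power rule each inserted [v *m v^T] splits its term into a product of two
    moments. *)
Lemma derivable_pt_lim_form_expmx n (H : 'M[R]_n) (v : 'cV[R]_n) k t :
  let B s := H + s *: (v *m v^T) in
  derivable_pt_lim (fun s => form (B s ^+ k) v v) t
    (\sum_(a < k) form (B t ^+ a) v v * form (B t ^+ (k.-1 - a)) v v).
Proof.
move=> B.
apply: (derivable_pt_lim_ext (fun s => \sum_i \sum_j v i 0 * (B s ^+ k) i j * v j 0)) => [s|].
  by rewrite formE.
have -> : \sum_(a < k) form (B t ^+ a) v v * form (B t ^+ (k.-1 - a)) v v =
  form (\sum_(a < k) B t ^+ a * (v *m v^T) * B t ^+ (k.-1 - a)) v v.
  rewrite form_sum; apply: eq_bigr => a _.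
  rewrite /form !mulmxA -[in RHS]mulmxA -(mulmxA (v^T)) -[in RHS](mulmxA _ v^T) [RHS]mxE big_ord1.
  by rewrite !mulmxA.
rewrite formE.
apply: derivable_pt_lim_sum => i; apply: derivable_pt_lim_sum => j.
set D := \sum_(a < k) _.
have -> : v i 0 * D i j * v j 0 = (0 * (B t ^+ k) i j + v i 0 * D i j) * v j 0 +
   v i 0 * (B t ^+ k) i j * 0 by ring.
apply: (derivable_pt_lim_mult (fun s => v i 0 * (B s ^+ k) i j) (fun=> v j 0)).
  apply: (derivable_pt_lim_mult (fun=> v i 0) (fun s => (B s ^+ k) i j)).
    exact: derivable_pt_lim_const.
  exact: derivable_pt_lim_expmx.
exact: derivable_pt_lim_const.
Qed.

(** Cyclicity of the trace makes the [k] terms of the power rule equal. *)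
Lemma derivable_pt_lim_mxtrace_expmx n (H : 'M[R]_n) (v : 'cV[R]_n) k t :
  let B s := H + s *: (v *m v^T) in
  derivable_pt_lim (fun s => \tr (B s ^+ k)) t (k%:R * form (B t ^+ k.-1) v v).
Proof.
move=> B.
have -> : k%:R * form (B t ^+ k.-1) v v =
  \tr (\sum_(a < k) B t ^+ a * (v *m v^T) * B t ^+ (k.-1 - a)).
  rewrite linear_sum /= (eq_bigr (fun=> form (B t ^+ k.-1) v v)) => [|a _].
    by rewrite sumr_const card_ord mulr_natl.
  have -> : \tr (B t ^+ a * (v *m v^T) * B t ^+ (k.-1 - a)) =
    \tr (B t ^+ (k.-1 - a) * (B t ^+ a * (v *m v^T))) by exact: mxtrace_mulC.
  rewrite mulrA -exprD subnK; last by have := ltn_ord a; lia.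
  transitivity (\tr ((B t ^+ k.-1 *m v) *m v^T)); first by rewrite -mulmxA.
  by rewrite mxtrace_mulC /form mulmxA /mxtrace big_ord1.
by apply: derivable_pt_lim_sum => i; exact: derivable_pt_lim_expmx.
Qed.

(* For [f t := \tr (H + t vv^T) ^+ N.+2] and [m a := <v, X ^+ a v>], one has
   [f' = N.+2 * m N.+1] and [f'' = N.+2 * \sum_a m a * m (N - a)].
   Log-convexity bounds each [m a * m (N - a)] by [m 0 * m N], and the lower
   bound on the spectrum gives [N.+1 * m N <= m N.+1], so [f'' <= |v|^2 f']. *)
Lemma mxtrace_expmx_rank1 n (H : 'M[R]_n) (v : 'cV[R]_n) N (T : R) :
  H^T = H -> v != 0 ->
  (forall t : R, `|t| <= T -> bounded_below (H + t *: (v *m v^T)) N.+1%:R) ->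
  forall t : R, `|t| <= T ->
  \tr ((H + t *: (v *m v^T)) ^+ N.+2) <= \tr (H ^+ N.+2) +
    (exp (form 1 v v * t) - 1) / form 1 v v * (N.+2%:R * form (H ^+ N.+1) v v).
Proof.
move=> sH nz bB t tT.
set B := fun s => H + s *: (v *m v^T); set r := form 1 v v.
have r_gt0 : 0 < r by exact: form1_gt0.
have df s : derivable_pt_lim (fun s => \tr (B s ^+ N.+2)) s
    (N.+2%:R * form (B s ^+ N.+1) v v) by exact: derivable_pt_lim_mxtrace_expmx.
have df1 s : derivable_pt_lim (fun s => N.+2%:R * form (B s ^+ N.+1) v v) s
    (N.+2%:R * \sum_(a < N.+1) form (B s ^+ a) v v * form (B s ^+ (N - a)) v v).
  have -> : N.+2%:R * \sum_(a < N.+1) form (B s ^+ a) v v * form (B s ^+ (N - a)) v v =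
   0 * form (B s ^+ N.+1) v v + N.+2%:R * 
     \sum_(a < N.+1) form (B s ^+ a) v v * form (B s ^+ (N - a)) v v by rewrite mul0r add0r.
  apply: (derivable_pt_lim_mult (fun=> N.+2%:R)).
    exact: derivable_pt_lim_const.
  exact: derivable_pt_lim_form_expmx.
have le21 s : Rabs s <= T ->
   N.+2%:R * \sum_(a < N.+1) form (B s ^+ a) v v * form (B s ^+ (N - a)) v v <=
   r * (N.+2%:R * form (B s ^+ N.+1) v v).
  move=> sT; rewrite mulrCA ler_wpM2l //.
  have sB : (B s)^T = B s by rewrite /B linearD /= linearZ /= trmx_mul trmxK sH.
  have N0 : 0 < N.+1%:R :> R by rewrite ltr0n.
  have bs : bounded_below (B s) N.+1%:R by apply: bB; rewrite -RabsE.
  have mono := form_expr_mono v sB N0 bs N.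
  apply: (@le_trans _ _ (\sum_(a < N.+1) r * form (B s ^+ N) v v)).
    apply: ler_sum => a _.
    have := form_expr_superM sB N0 bs a (N - a) nz.
    by rewrite expr0 subnKC // -ltnS.
  rewrite sumr_const card_ord -mulrnAr; apply: ler_wpM2l; first exact: ltW.
  by rewrite -mulr_natl.
have /RleP := exp_Gronwall (elimT RltP r_gt0) df df1
  (fun s h => elimT RleP (le21 s (introT RleP h))) (elimT RleP tT).
by rewrite /B -/r scale0r addr0.
Qed.

(** * Finite product measures and an abstract supermartingale bound *)

Section ProductMeasure.
Variables (F : realFieldType) (I C : finType) (mu : I -> C -> F).
Hypotheses (mu_ge0 : forall i c, 0 <= mu i c) (mu_sum : forall i, \sum_c mu i c = 1).
Implicit Type w : {ffun I -> C}.

Definition product_mass w : F := \prod_i mu i (w i).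

Definition resample w i c : {ffun I -> C} := [ffun j => if j == i then c else w j].

Lemma product_mass_ge0 w : 0 <= product_mass w.
Proof. by apply: prodr_ge0. Qed.

Lemma product_mass_sum : \sum_w product_mass w = 1.
Proof. by rewrite /product_mass -bigA_distr_bigA /= big1. Qed.

Lemma product_mass_resample w i c :
  product_mass (resample w i c) * mu i (w i) = product_mass w * mu i c.
Proof.
rewrite /product_mass (bigD1 i) //= [in RHS](bigD1 i) //= ffunE eqxx.
rewrite (eq_bigr (fun j => mu j (w j))); first by ring.
by move=> j /negPf ji; rewrite ffunE ji.
Qed.

(** Swapping coordinate [i] with an independent copy is an involution that preserves the joint law.
    It serves to integrate out one coordinate at a time. *)
Lemma expectation_resample i (G : {ffun I -> C} -> F) :
  \sum_w product_mass w * G w =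
  \sum_w product_mass w * \sum_c mu i c * G (resample w i c).
Proof.
pose h (x : {ffun I -> C} * C) := (resample x.1 i x.2, x.1 i).
have hK : involutive h.
  move=> [w c]; rewrite /h /= ffunE eqxx; congr pair; apply/ffunP => j.
  by rewrite !ffunE; case: eqP => // ->.
transitivity (\sum_(x : {ffun I -> C} * C) product_mass x.1 * mu i x.2 * G x.1).
  rewrite -(pair_bigA _ (fun w c => product_mass w * mu i c * G w)) /=.
  apply: eq_bigr => w _; rewrite -big_distrl -big_distrr /= mu_sum; by rewrite mulr1.
rewrite (reindex_inj (inv_inj hK)) /= -(pair_bigA _
  (fun w c => product_mass (resample w i c) * mu i (w i) * G (resample w i c))) /=.
apply: eq_bigr => w _; rewrite big_distrr /=; apply: eq_bigr => c _.
by rewrite product_mass_resample mulrA.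
Qed.

(* [Reg k] is the set of states from which [k] more increments keep the
   potential [Phi] in the region where it is a supermartingale. *)
Lemma expectation_supermartingale (V : zmodType) (D : I -> C -> V) (Phi : V -> F)
    (Reg : nat -> V -> Prop) (s : seq I) :
  uniq s ->
  (forall k X i c, i \in s -> Reg k.+1 X -> Reg k (X + D i c)) ->
  (forall k X i, i \in s -> Reg k.+1 X -> \sum_c mu i c * Phi (X + D i c) <= Phi X) ->
  forall X, Reg (size s) X ->
  \sum_w product_mass w * Phi (X + \sum_(i <- s) D i (w i)) <= Phi X.
Proof.
elim: s => [|i s IH] /=.
  move=> _ _ _ X _; under eq_bigr do rewrite big_nil addr0.
  by rewrite -big_distrl /= product_mass_sum mul1r.
case/andP => nis us HR HP X RX.
rewrite (expectation_resample i).
apply: (@le_trans _ _ (\sum_c mu i c *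
   \sum_w product_mass w * Phi (X + D i c + \sum_(j <- s) D j (w j)))).
  rewrite le_eqVlt; apply/orP; left; apply/eqP.
  under eq_bigr do rewrite big_distrr /=.
  rewrite exchange_big /=; apply: eq_bigr => c _.
  rewrite big_distrr /=; apply: eq_bigr => w _; rewrite mulrCA; congr (_ * (_ * Phi _)).
  rewrite big_cons ffunE eqxx addrA; congr (_ + _); apply: eq_big_seq => j js.
  by rewrite ffunE; case: eqP => // ji; rewrite -ji js in nis.
apply: le_trans (HP _ X i (mem_head _ _) RX).
apply: ler_sum => c _; apply: ler_wpM2l => //; apply: IH => //.
- by move=> k Y j d js; apply: HR; rewrite inE js orbT.
- by move=> k Y j js; apply: HP; rewrite inE js orbT.
- by apply: HR => //; rewrite mem_head.
Qed.

End ProductMeasure.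

(** * Edge vectors and sums over pairs of vertices *)

Section EdgeVectors.
Variables (F : realFieldType) (n : nat).
Implicit Types (e : 'I_n * 'I_n) (u : 'cV[F]_n).

Definition edge_vec e : 'cV[F]_n := delta_mx e.1 0 - delta_mx e.2 0.

Definition edges : seq ('I_n * 'I_n) := enum [pred e : 'I_n * 'I_n | (e.1 < e.2)%N].

Lemma mem_edges e : (e \in edges) = (e.1 < e.2)%N.
Proof. by rewrite mem_enum. Qed.

Lemma uniq_edges : uniq edges.
Proof. exact: enum_uniq. Qed.

Lemma form1_edge_vec e u : form 1 (edge_vec e) u = u e.1 0 - u e.2 0.
Proof.
rewrite /edge_vec -scaleN1r formDl formZl !form1E.
have E (i : 'I_n) : \sum_j (delta_mx i 0 : 'cV[F]_n) j 0 * u j 0 = u i 0.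
  rewrite (bigD1 i) //= mxE !eqxx mul1r big1 ?addr0 // => j ji.
  by rewrite mxE (negPf ji) mul0r.
by rewrite !E mulN1r.
Qed.

Lemma form1_edge_vec2 e : e.1 != e.2 -> form 1 (edge_vec e) (edge_vec e) = 2.
Proof.
move=> ne; rewrite form1_edge_vec !mxE !eqxx (negPf ne) eq_sym (negPf ne) /=.
by ring.
Qed.

Lemma sum_edges_sym (f : 'I_n -> 'I_n -> F) :
  (forall i j, f i j = f j i) -> (forall i, f i i = 0) ->
  \sum_i \sum_j f i j = 2 * \sum_(e <- edges) f e.1 e.2.
Proof.
move=> sf f0; rewrite pair_bigA /= /edges big_enum /=.
rewrite (bigID (fun e : 'I_n * 'I_n => (e.1 < e.2)%N)) /=.
have -> : 2 * \sum_(e : 'I_n * 'I_n | (e.1 < e.2)%N) f e.1 e.2 =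
 \sum_(e : 'I_n * 'I_n | (e.1 < e.2)%N) f e.1 e.2 +
 \sum_(e : 'I_n * 'I_n | (e.1 < e.2)%N) f e.1 e.2 by ring.
congr (_ + _).
rewrite (bigID (fun e : 'I_n * 'I_n => e.1 == e.2)) /= big1 ?add0r; last first.
  by move=> [i j] /= /andP[_ /eqP ->].
have swK : involutive (fun e : 'I_n * 'I_n => (e.2, e.1)) by case.
rewrite (reindex_inj (inv_inj swK)) /=; apply: eq_big => [[i j]|[i j] _] //=.
by rewrite -leqNgt ltn_neqAle andbC eq_sym.
Qed.

(** The Laplacian of the complete graph is [n] times the identity minus the all-ones matrix, which
    kills vectors of zero sum. *)
Lemma sum_edges_sqr u : \sum_i u i 0 = 0 ->
  \sum_(e <- edges) (u e.1 0 - u e.2 0) ^+ 2 = n%:R * form 1 u u.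
Proof.
move=> u0; have n2 : 2 != 0 :> F by rewrite pnatr_eq0.
apply: (mulfI n2); rewrite -(@sum_edges_sym (fun i j => (u i 0 - u j 0) ^+ 2)); last first.
- by move=> i; rewrite subrr expr0n.
- by move=> i j; ring.
have E i : \sum_j (u i 0 - u j 0) ^+ 2 = n%:R * (u i 0 * u i 0) + form 1 u u.
  rewrite (eq_bigr (fun j => u i 0 * u i 0 + u j 0 * u j 0 - 2 * u i 0 * u j 0)); last first.
    by move=> j _; ring.
  rewrite sumrB big_split /= sumr_const card_ord -big_distrr /= u0 mulr0 subr0.
  by rewrite form1E mulr_natl.
rewrite (eq_bigr _ (fun i _ => E i)) big_split /= -big_distrr /= -form1E.
rewrite sumr_const card_ord -(mulr_natl (form 1 u u)); by ring.
Qed.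

End EdgeVectors.

(** * The Chernoff bound for the random weighted Laplacian *)

Section LaplacianTail.
Variables (n : nat) (C : finType) (mu : 'I_n * 'I_n -> C -> R) (tau : C -> R).
Hypotheses (mu_ge0 : forall e c, 0 <= mu e c) (mu_sum : forall e, \sum_c mu e c = 1).
Hypothesis tau_mgf : forall e : 'I_n * 'I_n, (e.1 < e.2)%N ->
  \sum_c mu e c * exp (2 * tau c) = 1.
Implicit Types (w : {ffun 'I_n * 'I_n -> C}) (e : 'I_n * 'I_n).

Definition edge_laplacian (e : 'I_n * 'I_n) : 'M[R]_n := edge_vec R e *m (edge_vec R e)^T.

Definition weighted_laplacian w : 'M[R]_n :=
  \sum_(e <- edges n) tau (w e) *: edge_laplacian e.

Definition tau_bound := \sum_c `|tau c|.

(** The most that all edges together can lower the spectrum; the 2 is the squared norm of an edge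
    vector. *)
Definition spectral_slack := (size (edges n))%:R * (2 * tau_bound).

Lemma tau_le c : `|tau c| <= tau_bound.
Proof. by rewrite /tau_bound (bigD1 c) //= lerDl sumr_ge0. Qed.

Lemma tau_bound_ge0 : 0 <= tau_bound.
Proof. by apply: sumr_ge0. Qed.

Lemma spectral_slack_ge0 : 0 <= spectral_slack.
Proof. by do 2!apply: mulr_ge0 => //; exact: tau_bound_ge0. Qed.

Lemma edge_laplacian_tr e : (edge_laplacian e)^T = edge_laplacian e.
Proof. by rewrite trmx_mul trmxK. Qed.

Lemma form_edge_laplacian e (u : 'cV[R]_n) :
  form (edge_laplacian e) u u = (u e.1 0 - u e.2 0) ^+ 2.
Proof. by rewrite form_outer form1_edge_vec -expr2. Qed.

(* From here [k] more edges can be added while the spectrum stays above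
   [N.+1], as [mxtrace_expmx_rank1] requires for the exponent [N.+2]. *)
Definition region N k (X : 'M[R]_n) :=
  X^T = X /\ bounded_below X (N.+1%:R + k%:R * (2 * tau_bound)).

Lemma region_step N k X e (t : R) : (e.1 < e.2)%N -> `|t| <= tau_bound ->
  region N k.+1 X -> region N k (X + t *: edge_laplacian e).
Proof.
move=> lt_e le_t [sX bX]; split; first by rewrite linearD linearZ /= edge_laplacian_tr sX.
have := bounded_below_outer t (edge_vec R e) bX.
rewrite form1_edge_vec2 ?neq_ltn ?lt_e // => b u; apply: le_trans (b u).
apply: ler_wpM2r; first exact: form1_ge0.
by rewrite -natr1; lra.
Qed.

Lemma bounded_below_region N k X : region N k X -> bounded_below X N.+1%:R.
Proof.
case=> _ bX u; apply: le_trans (bX u); apply: ler_wpM2r; first exact: form1_ge0.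
by rewrite lerDl; do 2!apply: mulr_ge0 => //; exact: tau_bound_ge0.
Qed.

(** Averaging the rank-one bound leaves a first-order term proportional to the mean of
    [exp (2 * tau c) - 1], which vanishes by [tau_mgf]. *)
Lemma expectation_mxtrace_step N k X e : (e.1 < e.2)%N -> region N k.+1 X ->
  \sum_c mu e c * \tr ((X + tau c *: edge_laplacian e) ^+ N.+2) <= \tr (X ^+ N.+2).
Proof.
move=> lt_e RX.
have v2 : form 1 (edge_vec R e) (edge_vec R e) = 2 by rewrite form1_edge_vec2 // neq_ltn lt_e.
have nz : edge_vec R e != 0.
  apply/eqP => v0; move: v2; rewrite v0 /form mulmx0 mxE => /eqP.
  by rewrite eq_sym pnatr_eq0.
set M := N.+2%:R * form (X ^+ N.+1) (edge_vec R e) (edge_vec R e).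
apply: (@le_trans _ _ (\sum_c mu e c * (\tr (X ^+ N.+2) + (exp (2 * tau c) - 1) / 2 * M))).
  apply: ler_sum => c _; apply: ler_wpM2l => //.
  have := @mxtrace_expmx_rank1 _ X (edge_vec R e) N tau_bound RX.1 nz.
  rewrite v2 -/M; apply; last exact: tau_le.
  by move=> t le_t; apply: (@bounded_below_region N k); exact: region_step.
rewrite le_eqVlt; apply/orP; left; apply/eqP.
rewrite (eq_bigr (fun c => mu e c * (\tr (X ^+ N.+2) - M / 2) +
   mu e c * exp (2 * tau c) * (M / 2))); last by move=> c _; ring.
by rewrite big_split /= -!big_distrl /= mu_sum tau_mgf //; ring.
Qed.

Lemma expectation_mxtrace N c : c = N.+1%:R + spectral_slack ->
  \sum_w product_mass mu w * \tr ((c%:M + weighted_laplacian w) ^+ N.+2) <=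
  n%:R * c ^+ N.+2.
Proof.
move=> cE.
have -> : n%:R * c ^+ N.+2 = \tr (c%:M ^+ N.+2 : 'M[R]_n).
  rewrite mulr_natl -mxtrace_scalar; congr (mxtrace _).
  by elim: (N.+2) => [|k IH]; rewrite ?expr0 // !exprS -IH; exact: scalar_mxM.
apply: (@expectation_supermartingale _ _ _ mu mu_ge0 mu_sum _
  (fun e a => tau a *: edge_laplacian e) (fun X => \tr (X ^+ N.+2)) (region N)).
- exact: uniq_edges.
- by move=> k X e a; rewrite mem_edges => lt_e; apply: region_step => //; exact: tau_le.
- by move=> k X e; rewrite mem_edges; exact: expectation_mxtrace_step.
- rewrite cE; split; first by rewrite tr_scalar_mx.
  by move=> u; rewrite /form -scalemx1 -!scalemxAr -!scalemxAl [X in _ <= X]mxE.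
Qed.

(** Pathwise rather than on average: the slack in the starting matrix pays for every edge of any
    outcome. *)
Lemma region_final N w :
  let X := (N.+1%:R + spectral_slack)%:M + weighted_laplacian w in
  X^T = X /\ bounded_below X N.+1%:R.
Proof.
move=> X.
suff RX : region N 0 X by split; [exact: RX.1 | exact: bounded_below_region RX].
have H s k : all (fun e : 'I_n * 'I_n => (e.1 < e.2)%N) s ->
   forall Y, region N (size s + k) Y -> 
   region N k (Y + \sum_(e <- s) tau (w e) *: edge_laplacian e).
  elim: s => [|e s IH] /=; first by move=> _ Y; rewrite big_nil addr0.
  case/andP => lt_e al Y RY; rewrite big_cons addrA; apply: IH => //.
  by apply: region_step => //; exact: tau_le.
apply: H; first by apply/allP => e; rewrite mem_edges.
rewrite addn0; split; first by rewrite tr_scalar_mx.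
by move=> u; rewrite /form -scalemx1 -!scalemxAr -!scalemxAl [X in _ <= X]mxE.
Qed.

(** For [v] the normalised [u], [<v, Xv> >= c + g]; Jensen carries this to [<v, X^m v>], which the
    trace dominates. *)
Lemma mxtrace_lower_bound k m c w (u : 'cV[R]_n) (g : R) :
  m = (k.+1).*2 -> c = m%:R - 1 + spectral_slack -> u != 0 -> 0 <= g ->
  g * form 1 u u <= \sum_(e <- edges n) tau (w e) * (u e.1 0 - u e.2 0) ^+ 2 ->
  (c + g) ^+ m <= \tr ((c%:M + weighted_laplacian w) ^+ m).
Proof.
move=> mE0 cE0 nz g0 Hu.
have mE : m = (k.+1 + k.+1)%N by rewrite addnn.
(* The exponent is [m = N.+2] with [N = k.*2], so [m - 1] is the spectral bound [N.+1] of the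
   region. *)
have cE : c = (k.*2).+1%:R + spectral_slack by rewrite cE0 mE0 doubleS -natr1; ring.
have [sX bX] := region_final (k.*2) w.
move: sX bX; rewrite /= -cE; set X := c%:M + _ => sX bX.
have N0 : 0 < (k.*2).+1%:R :> R by rewrite ltr0n.
have c0 : 0 <= c by rewrite cE addr_ge0 // spectral_slack_ge0.
have u0 := form1_gt0 nz.
pose v := (Num.sqrt (form 1 u u))^-1 *: u.
have v1 : form 1 v v = 1.
  rewrite formZl formZr mulrA -invfM -expr2 sqr_sqrtr ?ltW // mulVf //.
  by rewrite gt_eqF.
have h1 : form X v v = (form 1 u u)^-1 * form X u u.
  by rewrite formZl formZr mulrA -invfM -expr2 sqr_sqrtr // ltW.
have h2 : c + g <= form (X ^+ 1) v v.
  rewrite expr1 h1 mulrC ler_pdivlMr // formDm /weighted_laplacian form_sum mulrDl.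
  apply: lerD; first by rewrite /form -scalemx1 -!scalemxAr -!scalemxAl [X in _ <= X]mxE.
  apply: le_trans Hu _; rewrite le_eqVlt; apply/orP; left; apply/eqP.
  by apply: eq_bigr => e _; rewrite formZm form_edge_laplacian.
apply: (@le_trans _ _ (form (X ^+ 1) v v ^+ m)).
  by apply: lerXn2r => //; rewrite nnegrE ?addr_ge0 //; apply: le_trans h2; rewrite addr_ge0.
apply: le_trans (form_expr_Jensen sX N0 bX m v1) _.
by have := form_expr_le_mxtrace v sX k.+1; rewrite v1 mulr1 -mE.
Qed.

(** Markov's inequality for the trace potential at each even exponent, then the limit
    [exp_limit_bound]. *)
Lemma laplacian_tail (bad : pred {ffun 'I_n * 'I_n -> C}) (g : R) : 0 <= g ->
  (forall w, bad w -> exists2 u : 'cV[R]_n, u != 0 &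
     g * form 1 u u <= \sum_(e <- edges n) tau (w e) * (u e.1 0 - u e.2 0) ^+ 2) ->
  \sum_(w | bad w) product_mass mu w <= n%:R * exp (- g).
Proof.
move=> g0 Hbad; apply/RleP.
apply: (@exp_limit_bound _ n%:R _ spectral_slack).
- by apply/RleP; apply: sumr_ge0 => w _; exact: product_mass_ge0.
- by apply/RleP; exact: ler0n.
- exact/RleP.
- exact/RleP/spectral_slack_ge0.
move=> k m; apply/RleP; rewrite !RpowE INRE.
set c := m%:R - 1 + spectral_slack.
change ((\sum_(w | bad w) product_mass mu w) * (c + g) ^+ m <= n%:R * c ^+ m).
have cE : c = (k.*2).+1%:R + spectral_slack by rewrite /c /m doubleS -natr1; ring.
have := expectation_mxtrace cE; rewrite -doubleS -/m; apply: le_trans.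
rewrite big_distrl /= big_mkcond /=; apply: ler_sum => w _.
have pw := product_mass_ge0 mu_ge0 w.
case: ifP => [/Hbad [u nz Hu]|_].
  by apply: ler_wpM2l => //; exact: (@mxtrace_lower_bound k _ _ _ u).
(* Off the bad event the trace must be nonnegative: its diagonal entries are values of a nonnegative
   form at basis vectors. *)
apply: mulr_ge0 => //; apply: sumr_ge0 => i _.
have [sX bX] := region_final (k.*2) w; move: sX bX; rewrite /= -cE => sX bX.
have N0 : 0 < (k.*2).+1%:R :> R by rewrite ltr0n.
have := form_expr_ge0 sX N0 bX m (delta_mx i 0).
by rewrite /form trmx_delta -rowE -colE !mxE.
Qed.

End LaplacianTail.

(** * From a positive Laplacian to a unique optimum of the semidefinite program *)

Section SDPCertificate.
Variables (F : realFieldType) (n : nat).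
Implicit Types (X : 'M[F]_n) (u : 'cV[F]_n) (alpha : 'I_n -> 'I_n -> F).

Lemma form_delta X i u : form X (delta_mx i 0) u = (X *m u) i 0.
Proof. by rewrite /form trmx_delta -rowE -row_mul mxE. Qed.

Lemma form_delta2 X i : form X (delta_mx i 0) (delta_mx i 0) = X i i.
Proof. by rewrite form_delta -colE mxE. Qed.

(** Symmetric Gaussian elimination, one index of [s] at a time. Keeping the weights apart from the
    vectors avoids square roots. *)
Lemma psd_rank1_sum X : X^T = X -> (forall u, 0 <= form X u u) ->
  exists2 l : seq (F * 'cV[F]_n), all (fun z => 0 <= z.1) l &
    X = \sum_(z <- l) z.1 *: (z.2 *m z.2^T).
Proof.
suff H (s : seq 'I_n) Y : Y^T = Y -> (forall u, 0 <= form Y u u) ->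
    (forall i j, i \notin s -> Y i j = 0) ->
    exists2 l : seq (F * 'cV[F]_n), all (fun z => 0 <= z.1) l &
      Y = \sum_(z <- l) z.1 *: (z.2 *m z.2^T).
  by move=> sX pX; apply: (H (enum 'I_n)) => // i j; rewrite mem_enum.
elim: s Y => [|i s IH] Y sY pY Y0.
  by exists [::] => //; rewrite big_nil; apply/matrixP => i j; rewrite Y0 ?mxE.
have CS u : ((Y *m u) i 0) ^+ 2 <= Y i i * form Y u u.
  by rewrite -form_delta -(form_delta2 Y); exact: form_CS.
have YC j k : Y j k = Y k j by rewrite -{1}sY mxE.
have d0 : 0 <= Y i i by rewrite -form_delta2.
(* If the pivot is zero, Cauchy-Schwarz forces row [i] to vanish; otherwise the Schur complement
   stays positive, again by [CS]. *)
case: (eqVneq (Y i i) 0) => [Yii|Yii].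
  apply: IH => // j k js; case: (eqVneq j i) => [->|ji]; last first.
    by apply: Y0; rewrite inE negb_or ji.
  have := CS (delta_mx k 0); rewrite Yii mul0r -colE mxE => h.
  by apply/eqP; rewrite -sqrf_eq0 eq_le h sqr_ge0.
pose y := col i Y.
have [] := IH (Y - (Y i i)^-1 *: (y *m y^T)).
- by rewrite linearB /= linearZ /= trmx_mul trmxK sY.
- move=> u; rewrite -scaleN1r formDm !formZm form_outer mulN1r subr_ge0.
  have -> : form 1 y u = (Y *m u) i 0.
    by rewrite form1E mxE; apply: eq_bigr => j _; rewrite mxE YC.
  by rewrite -expr2 mulrC ler_pdivrMr 1?mulrC // lt_neqAle eq_sym Yii d0.
- move=> j k js; rewrite !mxE big_ord1 !mxE.
  case: (eqVneq j i) => [->|ji]; first by rewrite (YC k i); field.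
  have jis : j \notin i :: s by rewrite inE negb_or ji.
  by rewrite (Y0 j k) // (Y0 j i) // mul0r mulr0 subr0.
move=> l al El; exists (((Y i i)^-1, y) :: l).
  by rewrite /= invr_ge0 d0.
by rewrite big_cons /= -El addrCA subrr addr0.
Qed.

(** With unit diagonal, [2 * (1 - X i j) = X i i + X j j - 2 * X i j], so the rank-one decomposition
    turns twice the sum into a nonnegative combination of values of [Q]. *)
Lemma laplacian_pos_certificate alpha X :
  (forall u i j, u i 0 <> u j 0 ->
     0 < \sum_i \sum_j alpha i j * (u i 0 - u j 0) ^+ 2) ->
  X^T = X -> (forall u, 0 <= form X u u) -> (forall i, X i i = 1) ->
  (exists i j, X i j <> 1) ->
  0 < \sum_i \sum_j alpha i j * (1 - X i j).
Proof.
move=> pos sX pX X1 [i0 [j0 X01]].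
have [l al El] := psd_rank1_sum sX pX.
pose Q u := \sum_i \sum_j alpha i j * (u i 0 - u j 0) ^+ 2.
have E : 2 * (\sum_i \sum_j alpha i j * (1 - X i j)) = \sum_(z <- l) z.1 * Q z.2.
  have Xij i j : X i j = \sum_(z <- l) z.1 * (z.2 i 0 * z.2 j 0).
    by rewrite {1}El summxE; apply: eq_bigr => z _; rewrite !mxE big_ord1 !mxE.
  rewrite big_distrr /= (eq_bigr (fun i => \sum_j \sum_(z <- l)
      z.1 * (alpha i j * (z.2 i 0 - z.2 j 0) ^+ 2))); last first.
    move=> i _; rewrite big_distrr /=; apply: eq_bigr => j _.
    have -> : 2 * (alpha i j * (1 - X i j)) =
       alpha i j * (X i i + X j j - 2 * X i j) by rewrite !X1; ring.
    rewrite !Xij (big_distrr 2) /= -big_split /= -sumrB big_distrr /=.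
    by apply: eq_bigr => z _; ring.
  rewrite (eq_bigr (fun i => \sum_(z <- l) \sum_j
     z.1 * (alpha i j * (z.2 i 0 - z.2 j 0) ^+ 2))); last by move=> i _; exact: exchange_big.
  rewrite exchange_big /=; apply: eq_bigr => z _; rewrite /Q big_distrr /=.
  by apply: eq_bigr => i _; rewrite big_distrr.
have Qcst u : (forall i j, u i 0 = u j 0) -> Q u = 0.
  move=> cu; rewrite /Q big1 // => i _; rewrite big1 // => j _.
  by rewrite (cu i j) subrr expr0n mulr0.
have Qdec u : (forall i j, u i 0 = u j 0) \/ 0 < Q u.
  have [/forallP cu|] := boolP [forall i, forall j, u i 0 == u j 0].
    by left=> i j; apply/eqP; move/forallP: (cu i).
  by rewrite negb_forall => /existsP[i]; rewrite negb_forall => /existsP[j /eqP/pos]; right.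
have Q_ge0 u : 0 <= Q u by case: (Qdec u) => [/Qcst ->//|/ltW].
rewrite -(pmulr_rgt0 _ (ltr0Sn F 1)) E lt_neqAle eq_sym.
have t_ge0 z : z \in l -> 0 <= z.1 * Q z.2.
  by move=> zl; apply: mulr_ge0 => //; exact: (allP al).
apply/andP; split; last by rewrite big_seq; apply: sumr_ge0.
(* If the sum vanishes, each vector of nonzero weight is constant, hence [X i0 j0 = X i0 i0 = 1]. *)
apply/eqP => S0; apply: X01; rewrite -(X1 i0) El !summxE.
apply: eq_big_seq => z zl; rewrite !mxE !big_ord1 !mxE.
have : z.1 * Q z.2 = 0.
  apply/eqP; rewrite eq_le t_ge0 // andbT -S0 (big_rem z zl) /= lerDl.
  by rewrite big_seq; apply: sumr_ge0 => y /mem_rem; exact: t_ge0.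
move/eqP; rewrite mulf_eq0 => /orP[/eqP ->|/eqP Q0]; first by rewrite !mul0r.
by case: (Qdec z.2) => [cz|]; rewrite ?Q0 ?ltxx // (cz j0 i0).
Qed.

End SDPCertificate.

(** Conjugation by the signs [g] preserves feasibility and sends [gg^T] to the all-ones matrix, the
    case treated by the certificate. *)
Lemma unique_opt_of_laplacian n (W : 'I_n -> 'I_n -> R) (g : 'I_n -> R) :
  (forall i, g i * g i = 1) ->
  (forall (u : 'cV[R]_n) i j, u i 0 <> u j 0 ->
     0 < \sum_i \sum_j (W i j * g i * g j) * (u i 0 - u j 0) ^+ 2) ->
  unique_opt W (fun i j => Rmult (g i) (g j)).
Proof.
move=> g1 pos; split.
  split; last by move=> i; exact: g1.
  split; first by move=> i j; exact: Rmult_comm.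
  move=> v; apply/RleP.
  change (0 <= \sum_i \sum_j v i * (g i * g j) * v j).
  have -> : \sum_i \sum_j v i * (g i * g j) * v j = (\sum_i v i * g i) ^+ 2.
    rewrite expr2 big_distrl /=; apply: eq_bigr => i _; rewrite big_distrr /=.
    by apply: eq_bigr => j _; ring.
  exact: sqr_ge0.
move=> X [[sX pX] X1] XY.
pose M : 'M[R]_n := \matrix_(i, j) (g i * X i j * g j).
apply/RltP; change (\sum_i \sum_j W i j * X j i < \sum_i \sum_j W i j * (g j * g i)).
rewrite -subr_gt0 -sumrB.
have -> : \sum_i (\sum_j W i j * (g j * g i) - \sum_j W i j * X j i) =
   \sum_i \sum_j (W i j * g i * g j) * (1 - M i j).
  apply: eq_bigr => i _; rewrite -sumrB; apply: eq_bigr => j _; rewrite mxE (sX i j).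
  have -> : W i j * g i * g j * (1 - g i * X j i * g j) =
    W i j * (g j * g i) - W i j * X j i * (g i * g i) * (g j * g j) by ring.
  by rewrite !g1 !mulr1.
apply: laplacian_pos_certificate => //.
- by apply/matrixP => i j; rewrite !mxE (sX j i); ring.
- move=> u; rewrite formE (eq_bigr (fun i => \sum_j (u i 0 * g i) * X i j * (u j 0 * g j))).
    exact/RleP/(pX (fun i => u i 0 * g i)).
  by move=> i _; apply: eq_bigr => j _; rewrite mxE; ring.
- by move=> i; rewrite mxE X1 mulr1 g1.
have [/forallP H|] := boolP [forall i, forall j, M i j == 1]; last first.
  rewrite negb_forall => /existsP[i]; rewrite negb_forall => /existsP[j /eqP h].
  by exists i, j.
case: XY; apply: functional_extensionality => i; apply: functional_extensionality => j.
have /eqP := forallP (H i) j; rewrite mxE => Mij.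
have -> : X i j = (g i * X i j * g j) * g i * g j by
  rewrite -[LHS]mulr1 -[in LHS](g1 j) -[LHS]mulr1 -[in LHS](g1 i); ring.
by rewrite Mij mul1r.
Qed.

(** * The random graph model as a product measure *)

Lemma big_bool2 (f : bool * bool -> R) :
  \sum_c f c = f (true, true) + f (true, false) + (f (false, true) + f (false, false)).
Proof.
rewrite (eq_bigr (fun c => f (c.1, c.2))) => [|[a b] _] //.
by rewrite -(pair_bigA _ (fun a b => f (a, b))) /= !big_bool.
Qed.

Section Model.
Variables (n : nat) (p eps : R) (x : 'I_n -> bool).
Hypotheses (p01 : Rle 0 p /\ Rle p 1) (eps01 : Rle 0 eps /\ Rlt eps (Rdiv 1 2)).

Definition edge_law (e : 'I_n * 'I_n) (c : bool * bool) : R := coord_weight p eps e.1 e.2 c.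

Lemma edge_law_ge0 e c : 0 <= edge_law e c.
Proof.
case: p01 eps01 => [p0 p1] [e0 e1].
suff : Rle 0 (edge_law e c) by move/RleP.
rewrite /edge_law /coord_weight.
case: ifP => _; last by case: eqP => _; Lra.lra.
by case: c => [[] []] /=; apply: Rmult_le_pos; Lra.lra.
Qed.

Lemma edge_law_sum e : \sum_c edge_law e c = 1.
Proof.
rewrite big_bool2 /edge_law /coord_weight; case: ifP => _ /=; last by rewrite !add0r.
by rewrite -!(RmultE, RplusE) -R1E; Lra.lra.
Qed.

Lemma edge_law_mgf (e : 'I_n * 'I_n) : (e.1 < e.2)%N ->
  \sum_c edge_law e c * exp (2 * tilt p (1 - 2 * eps) c) = 1.
Proof.
move=> lt_e; rewrite big_bool2 /edge_law /coord_weight /= lt_e.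
exact: (tilt_mgf p01 eps01).
Qed.

Lemma gvec_sqr i : gvec x i * gvec x i = 1.
Proof. by rewrite /gvec; case: (x i); rewrite -RmultE -R1E; Lra.lra. Qed.

Definition signed_edge (w : outcome n) (i j : 'I_n) := Wmat x w i j * gvec x i * gvec x j.

Lemma signed_edgeE w (i j : 'I_n) : (i < j)%N -> signed_edge w i j = sign_weight (w (i, j)).
Proof.
move=> ij; rewrite /signed_edge /Wmat /gvec /sign_weight /= ij.
have -> : (i == j) = false by rewrite -val_eqE ltn_eqF.
case: (w (i, j)) => [[] z] /=; rewrite -!RmultE; last by Lra.lra.
by case: (x i); case: (x j); case: z => /=; Lra.lra.
Qed.

Lemma signed_edgeC w i j : signed_edge w i j = signed_edge w j i.
Proof.
rewrite /signed_edge mulrAC; congr (_ * _ * _); rewrite /Wmat eq_sym.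
by case: eqP => // ne /=; case: (ltngtP i j) => // ij; case: ne; apply: val_inj.
Qed.

(** Contrapositive of the certificate. The zero sum prepares for [sum_edges_sqr]. *)
Lemma not_unique_opt_direction w : (0 < n)%N ->
  ~ unique_opt (Wmat x w) (fun i j => Rmult (gvec x i) (gvec x j)) ->
  exists u : 'cV[R]_n, [/\ u != 0, \sum_i u i 0 = 0 &
    \sum_(e <- edges n) sign_weight (w e) * (u e.1 0 - u e.2 0) ^+ 2 <= 0].
Proof.
move=> n0 bad; apply: NNPP => no; apply: bad.
apply: unique_opt_of_laplacian; first exact: gvec_sqr.
move=> u i0 j0 uij; rewrite ltNge; apply/negP => le0; apply: no.
(* Subtracting the mean leaves all differences, hence the Laplacian form, unchanged. *)
pose a := (\sum_i u i 0) / n%:R; pose v : 'cV[R]_n := \col_i (u i 0 - a).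
exists v; split.
- apply/eqP => v0; apply: uij.
  have vE i : u i 0 = a by move/colP/(_ i): v0; rewrite !mxE => /eqP; rewrite subr_eq0 => /eqP.
  by rewrite !vE.
- rewrite (eq_bigr (fun i => u i 0 - a)) => [|i _]; last by rewrite mxE.
  rewrite sumrB sumr_const card_ord -(mulr_natr a) divfK ?subrr //.
  by rewrite pnatr_eq0 -lt0n.
have two : 0 < 2 :> R by [].
rewrite -(pmulr_rle0 _ two); apply: le_trans le0.
rewrite (@sum_edges_sym _ _ (fun i j => signed_edge w i j * (u i 0 - u j 0) ^+ 2)); last first.
- by move=> i; rewrite subrr expr0n mulr0.
- by move=> i j; rewrite signed_edgeC; congr (_ * _); ring.
rewrite le_eqVlt; apply/orP; left; apply/eqP; congr (_ * _).
apply: eq_big_seq => [[i j]]; rewrite mem_edges /= => ij.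
by rewrite signed_edgeE // !mxE; congr (_ * _ ^+ 2); ring.
Qed.

End Model.

(** * The recovery probability *)

Local Open Scope R_scope.

Theorem theorem4 (n : nat) (p eps delta : R) (x : 'I_n -> bool)
  (Hp : 0 <= p <= 1) (Heps : 0 <= eps < 1 / 2) (Hdelta : 0 < delta)
  (Hd : (INR n - 1) * p / ln (INR n) >=
        (1 + delta) * (4 / (1 - 2 * eps) ^ 2 + 4 / (3 * (1 - 2 * eps)))) :
  prob p eps (fun w => unique_opt (Wmat x w) (fun i j => gvec x i * gvec x j))
    >= 1 - Rpower (INR n) (- delta).
Proof.
set good := fun w : outcome n => unique_opt _ _.
have hq : 0 < 1 - 2 * eps <= 1 by Lra.lra.
have n1 : 1 < INR n.
  apply: degree_condition_gt1 Hd; apply: Rmult_lt_0_compat; first by Lra.lra.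
  apply: Rplus_lt_0_compat; apply: Rdiv_lt_0_compat; try Lra.lra.
  by apply: pow_lt; Lra.lra.
have n0 : (0 < n)%N by case: (n) n1 => //= h; exfalso; Lra.lra.
pose bad (w : outcome n) := if excluded_middle_informative (good w) then false else true.
pose q := 1 - 2 * eps.
pose th := ln (1 + q) / 2; pose ph := ln (mean_mgf p q) / 2.
pose g := - ph * INR n.
have [E0 E1] := mean_mgf_bounds Hp hq.
have g0 : 0 <= g.
  apply: Rmult_le_pos; last by Lra.lra.
  have : ln (mean_mgf p q) <= 0.
    by case: E1 => [E1|->]; rewrite -ln_1; [apply/Rlt_le/ln_increasing|exact: Rle_refl].
  rewrite /ph; Lra.lra.
have th0 : 0 <= th.
  have : 0 < ln (1 + q) by rewrite -ln_1; apply: ln_increasing; rewrite /q; Lra.lra.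
  rewrite /th; Lra.lra.
have tiltE c : tilt p q c = (- th * sign_weight c - ph)%R by [].
have /RleP tail : is_true (\sum_(w | bad w) product_mass (edge_law p eps) w <= n%:R * exp (- g))%R.
  apply: (@laplacian_tail n _ (edge_law p eps) (tilt p q)).
  - exact: edge_law_ge0.
  - exact: edge_law_sum.
  - exact: edge_law_mgf.
  - exact/RleP.
  move=> w bad_w.
  have [u [nz u0 Hu]] : exists u : 'cV[R]_n, [/\ u != 0%R, (\sum_i u i 0 = 0)%R &
     is_true (\sum_(e <- edges n) sign_weight (w e) * (u e.1 0 - u e.2 0) ^+ 2 <= 0)%R].
    apply: (not_unique_opt_direction (x := x)) => //.
    by move: bad_w; rewrite /bad; case: excluded_middle_informative.
  exists u => //.
  (* The signed part is nonnegative since [th >= 0] and [Hu] holds; the constant part [- ph] over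
     all pairs gives exactly [g * form 1 u u]. *)
  rewrite (eq_bigr (fun e => (- th * (sign_weight (w e) * (u e.1 0 - u e.2 0) ^+ 2) +
    - ph * (u e.1 0 - u e.2 0) ^+ 2)%R)); last by move=> e _; rewrite tiltE; ring.
  rewrite big_split /= -!big_distrr /= sum_edges_sqr // /g INRE mulrA lerDr.
  by apply: mulr_le0 => //; rewrite oppr_le0; exact/RleP.
have le_pow := tail_le_Rpower n1 Hp hq Hdelta Hd.
have probE : prob p eps good = (\sum_(w | ~~ bad w) product_mass (edge_law p eps) w)%R.
  rewrite /prob [RHS]big_mkcond /=; apply: eq_bigr => w _.
  by rewrite /bad; case: excluded_middle_informative.
have := product_mass_sum (@edge_law_sum n p eps); rewrite (bigID bad) /= -probE.
move: tail; rewrite -INRE; set S := bigop.body _ _ _ => tail sum1.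
have {}tail : S <= Rpower (INR n) (- delta) by exact: Rle_trans tail le_pow.
have {}sum1 : S + prob p eps good = 1 := sum1.
Lra.lra.
Qed.
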